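(* Let $T$ be a finite rooted tree with node set $\mathcal V$, cost function $c:\mathcal V\to\mathbb R_{\ge0}$, integer budget $B\ge1$, and importance function $r:\mathcal V\to\mathbb R_{>0}$. Let $\mathbf v$ be a nonempty hypernode with $\mathrm{Cost}(T_{\mathbf v})>0$, and let $\mathbf x_0=\mathbf v,\mathbf x_1,\dots,\mathbf x_\tau$ be the random sequence of hypernodes produced by the SEI algorithm started at $\mathbf v$. Assume that $\mathrm{Cost}(T_{S(\mathbf u)})>0$ for every hypernode $\mathbf u$ with $S(\mathbf u)\neq\emptyset$ that occurs with positive probability in this sequence. Then \[\mathrm{CV}^2\big(|\mathbf v|C_{\mathrm{SEI}}(T_{\mathbf v})\big)\le\mathrm{Var}\big(\alpha(\mathbf x_0,\mathbf x_1,\dots,\mathbf x_\tau)\big).\]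
   Context: For a node $v$, $S(v)$ is its set of children and $T_v$ is the subtree rooted at $v$, with $\mathrm{Cost}(T_v)=\sum_{u\in T_v}c(u)$. A hypernode is a set of distinct nodes of $T$ all at the same depth. For a set of nodes $\mathbf v$: $c(\mathbf v)=\sum_{v\in\mathbf v}c(v)$, $r(\mathbf v)=\sum_{v\in\mathbf v}r(v)$, $S(\mathbf v)=\bigcup_{v\in\mathbf v}S(v)$, $T_{\mathbf v}=\bigcup_{v\in\mathbf v}T_v$, and $\mathrm{Cost}(T_{\mathbf v})=\sum_{v\in\mathbf v}\mathrm{Cost}(T_v)$. The hyperchildren of $\mathbf v$ are $H(\mathbf v)=\{\mathbf w\subseteq S(\mathbf v): |\mathbf w|=\min(B,|S(\mathbf v)|)\}$. For a random variable $X$ with $\mathbb E[X]>0$, $\mathrm{CV}^2(X)=\mathrm{Var}(X)/\mathbb E[X]^2$. SEI algorithm started at $\mathbf v$: set $k=0$, $\mathbf x_0=\mathbf v$, $D=1$, $C=c(\mathbf x_0)/|\mathbf x_0|$. Repeat: if $S(\mathbf x_k)=\emptyset$, stop (set $\tau=k$) and output $C_{\mathrm{SEI}}(T_{\mathbf v})=C$. Otherwise choose $\mathbf x_{k+1}\in H(\mathbf x_k)$ by first choosing $x\in S(\mathbf x_k)$ with probability $r(x)/r(S(\mathbf x_k))$ and then choosing the remaining $\min(B,|S(\mathbf x_k)|)-1$ elements of $\mathbf x_{k+1}$ as a uniformly random subset of $S(\mathbf x_k)\setminus\{x\}$ (fresh randomness at each step); set $D_k=\frac{|\mathbf x_{k+1}|}{|\mathbf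 x_k|}\cdot\frac{r(S(\mathbf x_k))}{r(\mathbf x_{k+1})}$, $D\leftarrow D\cdot D_k$, $C\leftarrow C+\frac{c(\mathbf x_{k+1})}{|\mathbf x_{k+1}|}D$, $k\leftarrow k+1$. The estimator $|\mathbf v|C_{\mathrm{SEI}}(T_{\mathbf v})$ has mean $\mathrm{Cost}(T_{\mathbf v})$. For a sequence of hypernodes $\mathbf x_0,\dots,\mathbf x_m$ with $\mathbf x_i\in H(\mathbf x_{i-1})$, define \[\alpha(\mathbf x_0,\dots,\mathbf x_m)=\prod_{i=1}^m\frac{r(S(\mathbf x_{i-1}))}{r(\mathbf x_i)}\cdot\frac{\mathrm{Cost}(T_{\mathbf x_i})}{\mathrm{Cost}(T_{S(\mathbf x_{i-1})})}\] (an empty product equals $1$). *)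

(* Defs.v *)
From HB Require Import structures.
From mathcomp Require Import all_boot all_order all_algebra.
From mathcomp Require Import all_classical all_reals all_analysis.

Set Implicit Arguments.
Unset Strict Implicit.
Unset Printing Implicit Defensive.

Import Order.TTheory GRing.Theory Num.Theory.

Local Open Scope ring_scope.

(* A rooted tree on the node set V, given by its parent map.  The root has no
   parent; by convention [parent] fixes it. *)
Record rooted_tree (V : finType) := RootedTree {
  root : V;
  parent : V -> V;
  parent_root : parent root = root;
  fconnect_root : forall x : V, fconnect parent x root
}.

Section tree.
Context {V : finType} (T : rooted_tree V).
Implicit Types (x : V) (v w : {set V}).

(* number of parent steps from x to the root *)
Definition depth x : nat := findex (parent T) x (root T).

Definition children x : {set V} :=
  [set y | (y != root T) && (parent T y == x)].

Definition subtree x : {set V} := [set y | fconnect (parent T) y x].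

Definition is_hypernode v : Prop := {in v &, forall x y, depth x = depth y}.

Definition hchildren v : {set V} := \bigcup_(x in v) children x.

Definition hyperchildren (B : nat) v : {set {set V}} :=
  [set w : {set V} | (w \subset hchildren v) &&
                     (#|w| == minn B #|hchildren v|)].

End tree.

Section weights.
Context {R : realType} {V : finType}.

Definition total (f : V -> R) (v : {set V}) : R := \sum_(x in v) f x.

Definition Cost (T : rooted_tree V) (c : V -> R) (x : V) : R :=
  total c (subtree T x).

Definition hCost (T : rooted_tree V) (c : V -> R) (v : {set V}) : R :=
  \sum_(x in v) Cost T c x.

End weights.

(* A run from x_0 = v is recorded as the sequence [:: x_1; ...; x_tau]; x_0 is
   always kept separate.  As each step goes one level down the tree,
   tau < #|V|, which justifies the bound on the length. *)
Definition run (V : finType) : Type := #|V|.-bseq {set V}.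

HB.instance Definition _ (V : finType) := Choice.on (run V).
HB.instance Definition _ (V : finType) :=
  isPointed.Build (run V) ([bseq] : #|V|.-bseq {set V}).
HB.instance Definition _ (V : finType) :=
  @isMeasurable.Build default_measure_display (run V)
    discrete_measurable discrete_measurable0
    discrete_measurableC discrete_measurableU.

Coercion seq_of_run (V : finType) (s : run V) : seq {set V} :=
  (s : #|V|.-bseq {set V}).

Section sei.
Context {R : realType} {V : finType} (T : rooted_tree V).
Variables (B : nat) (r : V -> R).
Implicit Types (x : V) (u v w : {set V}) (s : seq {set V}).

Let S := hchildren T.

(* possible values of the elements of x_{k+1} other than the first chosen
   one, x, when x_k = u *)
Definition completions u x : {set {set V}} :=
  [set A : {set V} | (A \subset S u :\ x) && (#|A| == (minn B #|S u|).-1)].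

(* probability that x_{k+1} = w given that x_k = u: the first element x has
   law r(x)/r(S(u)), and the set A of the remaining ones is uniform *)
Definition sei_step u w : R :=
  \sum_(x in S u) r x / total r (S u) *
    \sum_(A in completions u x | x |: A == w) #|completions u x|%:R^-1.

(* probability that the algorithm, when its current hypernode is u, visits
   next exactly the hypernodes listed in s and then stops *)
Fixpoint sei_pmf u s : R :=
  if s is w :: s' then
    if S u == finset.set0 then 0 else sei_step u w * sei_pmf w s'
  else if S u == finset.set0 then 1 else 0.

(* the main loop, with current hypernode u and current values D and C *)
Fixpoint sei_loop (c : V -> R) u (D C : R) s : R :=
  if s is w :: s' then
    let D' := D * (#|w|%:R / #|u|%:R * (total r (S u) / total r w)) in
    sei_loop c w D' (C + total c w / #|w|%:R * D') s'
  else C.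

Definition C_SEI (c : V -> R) v s : R :=
  sei_loop c v 1 (total c v / #|v|%:R) s.

(* alpha c u [:: x_1; ...; x_m] is alpha(u, x_1, ..., x_m) *)
Fixpoint alpha (c : V -> R) u s : R :=
  if s is w :: s' then
    total r (S u) / total r w * (hCost T c w / hCost T c (S u)) * alpha c w s'
  else 1.

Hypothesis r_gt0 : forall x, 0 < r x.

Lemma total_gt0 u : u != finset.set0 -> 0 < total r u.
Proof.
case/set0Pn => x xu; rewrite /total (bigD1 x) //=.
by rewrite ltr_pwDl // sumr_ge0 // => y _; exact: ltW.
Qed.

Lemma card_completions u x : x \in S u ->
  #|completions u x| = 'C(#|S u|.-1, (minn B #|S u|).-1).
Proof.
by move=> xu; rewrite cards_draws (cardsD1 x (S u)) xu.
Qed.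

Lemma completions_gt0 u x : x \in S u -> (0 < #|completions u x|)%N.
Proof.
move=> xu; rewrite card_completions // bin_gt0 -!subn1 leq_sub2r //.
exact: geq_minr.
Qed.

Lemma sei_step_ge0 u w : 0 <= sei_step u w.
Proof.
apply: sumr_ge0 => x xu; rewrite mulr_ge0 //.
  by rewrite divr_ge0 ?ltW // total_gt0 //; apply/set0Pn; exists x.
by apply: sumr_ge0 => A _; rewrite invr_ge0 ler0n.
Qed.

Lemma sei_step_hyperchildren u w : (0 < B)%N ->
  w \notin hyperchildren T B u -> sei_step u w = 0.
Proof.
move=> B0 wu; rewrite /sei_step big1 // => x xu.
rewrite big1 ?mulr0 // => A; rewrite inE => /andP[/andP[Au /eqP cA] /eqP Aw].
case/negP: wu; rewrite inE -Aw finset.subUset finset.sub1set xu /=.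
rewrite (fintype.subset_trans Au) ?finset.subsetDl //= cardsU1.
have -> : x \notin A.
  by apply/negP => /(fintype.subsetP Au); rewrite !inE eqxx.
rewrite cA add1n prednK // leq_min B0 /=.
by apply/card_gt0P; exists x.
Qed.

Lemma sei_step_subset u w : ~~ (w \subset S u) -> sei_step u w = 0.
Proof.
move=> wu; rewrite /sei_step big1 // => x xu.
rewrite big1 ?mulr0 // => A; rewrite inE => /andP[/andP[Au _] /eqP Aw].
case/negP: wu; rewrite -Aw finset.subUset finset.sub1set xu /=.
by rewrite (fintype.subset_trans Au) ?finset.subsetDl.
Qed.

Lemma sum_sei_step u : S u != finset.set0 -> \sum_w sei_step u w = 1.
Proof.
move=> Su; rewrite exchange_big /=.
transitivity (\sum_(x in S u) r x / total r (S u)); last first.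
  by rewrite -mulr_suml divff // gt_eqF // total_gt0.
apply: eq_bigr => x xu; rewrite -mulr_sumr.
rewrite (exchange_big_dep (mem (completions u x))) /=; last by move=> ? ? _ /andP[].
under eq_bigr => A Au.
  rewrite (eq_bigl (pred1 (x |: A))); last by move=> w; rewrite Au eq_sym.
  rewrite big_pred1_eq; over.
rewrite sumr_const -[X in _ * X]mulr_natl divff ?mulr1 //.
by rewrite pnatr_eq0 -lt0n completions_gt0.
Qed.

Lemma sei_pmf_ge0 u s : 0 <= sei_pmf u s.
Proof.
elim: s u => [|w s IHs] u /=; case: ifP => // _.
by rewrite mulr_ge0 ?sei_step_ge0.
Qed.

Lemma big_bseqS (I : finType) n (f : seq I -> R) :
  \sum_(s : n.+1.-bseq I) f s =
  f [::] + \sum_w \sum_(s : n.-bseq I) f (w :: s).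
Proof.
rewrite pair_big /= (bigD1 ([bseq] : n.+1.-bseq I)) //=; congr (_ + _).
pose h (p : I * n.-bseq I) : n.+1.-bseq I := cons_bseq p.1 p.2.
pose g (w0 : I) (s : n.+1.-bseq I) : I * n.-bseq I :=
  (head w0 s, insub_bseq n (behead s)).
case: (pickP (mem (predT : {pred I}))) => [w0 _|I0]; last first.
  rewrite !big1 // => [[w]|[[|w s] ss]]; first by have := I0 w.
    by move/eqP; case; exact: val_inj.
  by have := I0 w.
rewrite (reindex h) /=; first by apply: eq_bigl => -[].
exists (g w0) => [[w s] _|[[|w s] ss]]; rewrite /h /g /= ?inE.
- by congr (_, _); apply: val_inj; rewrite val_insubd size_bseq.
- by move/eqP; case; exact: val_inj.
- by move=> _; apply: val_inj; rewrite /= val_insubd -ltnS ss.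
Qed.

Lemma depth_child x y : x \in children T y -> depth T x = (depth T y).+1.
Proof.
rewrite inE => /andP[xr /eqP <-]; rewrite /depth fconnect_findex //.
  exact: fconnect_root.
by rewrite eq_sym.
Qed.

Lemma sum_sei_pmf u : \sum_(s : #|V|.-bseq {set V}) sei_pmf u s = 1.
Proof.
have H n : forall v, (forall x, x \in v -> #|V| <= depth T x + n)%N ->
    \sum_(s : n.-bseq {set V}) sei_pmf v s = 1.
  elim: n => [|n IHn] v vn.
    have v0 : v = finset.set0.
      apply/eqP; apply: contraT => /set0Pn[x /vn]; rewrite addn0 leqNgt.
      have xr := fconnect_root T x.
      by rewrite (leq_trans (findex_max xr)) // max_card.
    rewrite (big_pred1 ([bseq] : 0.-bseq {set V})) => [|s].
      by rewrite /= /S /hchildren v0 big_set0 eqxx.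
    by apply/esym/eqP/val_inj => /=; apply: size0nil; apply/eqP;
      rewrite -leqn0 size_bseq.
  rewrite big_bseqS /=; case: eqVneq => [_|Sv].
    by rewrite big1 ?addr0 // => w _; rewrite big1.
  rewrite add0r -[RHS](sum_sei_step Sv); apply: eq_bigr => w _.
  rewrite -mulr_sumr; have [wS|wS] := boolP (w \subset S v); last first.
    by rewrite sei_step_subset // mul0r.
  rewrite IHn ?mulr1 // => x /(fintype.subsetP wS) /bigcupP[y yv /depth_child ->].
  by rewrite addSnnS vn.
by apply: H => x _; rewrite leq_addl.
Qed.

End sei.

(* law of the run (x_1, ..., x_tau) of the algorithm started at v; the
   positivity of r makes it a probability measure *)
Definition sei_prob {R : realType} {V : finType} (T : rooted_tree V) (B : nat)
    {r : V -> R} (r_gt0 : forall x, 0 < r x) (v : {set V}) :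
    set (run V) -> \bar R :=
  fun A => (\esum_(s in A) (sei_pmf T B r v s)%:E)%E.

Section sei_probability.
Context {R : realType} {V : finType} (T : rooted_tree V) (B : nat)
  {r : V -> R} (r_gt0 : forall x, 0 < r x) (v : {set V}).
Local Open Scope ereal_scope.

Local Notation sei_prob := (@sei_prob R V T B r r_gt0 v).

Let sei_prob0 : sei_prob classical_sets.set0 = 0.
Proof. by rewrite /sei_prob esum_set0. Qed.

Let sei_pmf_pos (s : run V) : 0 <= (sei_pmf T B r v s)%:E.
Proof. by rewrite lee_fin sei_pmf_ge0. Qed.

Let sei_prob_ge0 A : 0 <= sei_prob A.
Proof. by apply: esum_ge0 => s _; exact: sei_pmf_pos. Qed.

Let sei_prob_sigma_additive : semi_sigma_additive sei_prob.
Proof.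
move=> F mF tF mUF; apply: cvg_toP.
  apply: ereal_nondecreasing_is_cvgn => a b ab.
  by apply: lee_sum_nneg_natr => // k _ _; exact: sei_prob_ge0.
by rewrite /sei_prob nneseries_sum_bigcup.
Qed.

HB.instance Definition _ := isMeasure.Build _ _ _ sei_prob
  sei_prob0 sei_prob_ge0 sei_prob_sigma_additive.

Let sei_prob_setT : sei_prob [set: run V]%classic = 1.
Proof.
rewrite /sei_prob -(sum_sei_pmf T B r_gt0 v) -sumEFin.
have fin : finite_set [set: run V]%classic.
  exact: (@finite_finset (#|V|.-bseq {set V})).
rewrite esum_fset //; last by move=> s _; exact: sei_pmf_pos.
rewrite (fsbigE (enum {: #|V|.-bseq {set V}})) ?enum_uniq //=; last first.
  by move=> s _; rewrite mem_enum.
rewrite big_mkcond /= big_enum /=.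
by apply: eq_bigr => s _; rewrite classical_sets.in_setT.
Qed.

HB.instance Definition _ :=
  @Measure_isProbability.Build _ _ R sei_prob sei_prob_setT.

End sei_probability.

Section cv.
Context d {Omega : measurableType d} {R : realType}.
Local Open Scope ereal_scope.

(* only meaningful when the mean is positive: in extended reals 0^-1 = +oo *)
Definition CV2 (P : probability Omega R) (X : Omega -> R) : \bar R :=
  'V_P[X] / ('E_P[X]) ^+ 2.

End cv.

(* Main.v *)
(* Write X_u = |u| C_SEI(T_u), K = Cost(T_{S(u)}) and q_w = r(S(u)) / r(w).  The
   law of the next hypernode w is proportional to r(w), so a sum over the
   elements of w, weighted by q_w, averages to the sum over S(u); this gives
   E[X_u] = Cost(T_u) and E[alpha] = 1.  Since X_u = c(u) + q_w X_w,
     E[X_u^2] = c(u)^2 + 2 c(u) K + E[q_w^2 X_w^2].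
   By induction down the tree the last term is at most K^2 E[alpha^2], and
   E[alpha^2] >= E[alpha]^2 = 1 absorbs the first two, whence
   E[X_u^2] <= (c(u) + K)^2 E[alpha^2] = Cost(T_u)^2 E[alpha^2].  Dividing by
   Cost(T_u)^2 and subtracting 1 is the claim. *)
Require Import Defs.
From mathcomp Require Import all_boot all_order all_algebra.
From mathcomp Require Import all_classical all_reals all_analysis.
From mathcomp Require Import ring lra.
Import Order.TTheory GRing.Theory Num.Theory.
Local Open Scope ring_scope.
Set Implicit Arguments.
Unset Strict Implicit.
Unset Printing Implicit Defensive.

(** * Depths, subtrees and their costs *)

Section tree_cost.
Context {V : finType} (T : rooted_tree V).
Implicit Types (x y z : V) (u w : {set V}).

Lemma depth_parent x : x != Defs.root T -> depth T x = (depth T (parent T x)).+1.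
Proof. by move=> xr; apply: depth_child; rewrite inE xr eqxx. Qed.

Lemma fconnect_depth x y : fconnect (parent T) x y -> (depth T y <= depth T x)%N.
Proof.
move=> /iter_findex <-; elim: (findex _ _ _) => //= n IHn.
have [->|xr] := eqVneq (iter n (parent T) x) (Defs.root T).
  by rewrite parent_root /depth findex0.
by apply: leq_trans IHn; rewrite (depth_parent xr).
Qed.

(** The two ways for [y] to be an ancestor of [x] exclude each other, because depth strictly
    decreases from [x] to its parent; hence a sum in [nat] rather than a disjunction. *)
Lemma fconnect_parentE x y : x != Defs.root T ->
  fconnect (parent T) x y = ((x == y) + fconnect (parent T) (parent T x) y)%N :> nat.
Proof.
move=> xr; rewrite fconnect_eqVf.
have [<-|//] := eqVneq x y.
suff /negbTE -> : ~~ fconnect (parent T) (parent T x) x by [].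
by apply/negP => /fconnect_depth; rewrite [leqLHS]depth_parent // ltnn.
Qed.

(** A subtree is the disjoint union of its root and its children's subtrees. Stated with indicators
    in [nat], this includes disjointness and can be summed against [c]. The proof climbs from [z] to
    its parent by induction on depth. *)
Lemma subtree_children x z :
  (z \in subtree T x) =
  ((z == x) + \sum_(y in children T x) (z \in subtree T y))%N :> nat.
Proof.
rewrite inE; under eq_bigr do rewrite inE.
elim: {z}(depth T z) {-2}z (erefl (depth T z)) => [|n IHn] z.
  have [->|zr] := eqVneq z (Defs.root T); last by rewrite depth_parent.
  have rootE y : fconnect (parent T) (Defs.root T) y = (Defs.root T == y).
    apply/idP/eqP => [/iter_findex <-|<-]; last exact: connect0.
    by rewrite iter_fix // parent_root.
  move=> _; rewrite rootE big1 => [|y]; first by rewrite addn0.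
  by rewrite inE rootE eq_sym => /andP[/negbTE-> _].
have [->|zr] := eqVneq z (Defs.root T); first by rewrite /depth findex0.
rewrite depth_parent // => -[zn]; rewrite fconnect_parentE // IHn //.
congr addn; under [in RHS]eq_bigr do rewrite fconnect_parentE //.
rewrite big_split /=; congr addn.
(* It remains to see that the number of children of [x] equal to [z] is 1 if [x] is the parent of
   [z], and 0 otherwise. *)
have [zx|zx] := eqVneq (parent T z) x.
  have zin : z \in children T x by rewrite inE zr zx eqxx.
  rewrite (bigD1 z) //= eqxx big1 ?addn0 // => y /andP[_].
  by rewrite eq_sym => /negbTE ->.
rewrite big1 // => y; rewrite inE => /andP[_ /eqP yx].
by case: eqVneq => // zy; rewrite -yx zy eqxx in zx.
Qed.

Context {R : realType}.
Implicit Type c : V -> R.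

Lemma Cost_children c x : Cost T c x = c x + \sum_(y in children T x) Cost T c y.
Proof.
have memE (A : {set V}) : Defs.total c A = \sum_z c z *+ (z \in A).
  by rewrite /Defs.total big_mkcond /=; apply: eq_bigr => z _; case: (z \in A).
rewrite /Cost; under eq_bigr do rewrite memE.
rewrite memE exchange_big /=; under eq_bigr do rewrite subtree_children mulrnDr.
rewrite big_split /=; congr (_ + _).
  rewrite (bigD1 x) //= eqxx big1 ?addr0 // => z /negbTE -> //.
by apply: eq_bigr => z _; rewrite sumrMnr.
Qed.

(** Sets of children of distinct nodes are disjoint, so the sum over [hchildren T u] can be split
    along the parent map. *)
Lemma hCost_hchildren c u : hCost T c u = Defs.total c u + hCost T c (hchildren T u).
Proof.
rewrite /hCost; under eq_bigr do rewrite Cost_children.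
rewrite big_split /=; congr (_ + _).
rewrite [RHS](partition_big (parent T) (mem u)) /=.
  apply: eq_bigr => x xu; apply: eq_bigl => y.
  apply/idP/andP => [yx|[/bigcupP[z zu]]].
    by split; [apply/bigcupP; exists x|case/setIdP: yx].
  by rewrite !inE => /andP[-> /eqP ->].
by move=> y /bigcupP[z zu]; rewrite inE => /andP[_ /eqP ->].
Qed.

Lemma is_hypernode_sub u w : is_hypernode T u -> w \subset hchildren T u ->
  is_hypernode T w.
Proof.
move=> hu /fintype.subsetP wu x y /wu/bigcupP[x' x'u /depth_child ->].
by move=> /wu/bigcupP[y' y'u /depth_child ->]; congr _.+1; exact: hu.
Qed.

End tree_cost.

(** * Expectation and variance of a run as finite sums *)

Section expectation.
Context {R : realType} {V : finType} (T : rooted_tree V) (B : nat)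
  (r : V -> R) (r_gt0 : forall x, 0 < r x) (v : {set V}).
Local Notation P := (sei_prob T B r_gt0 v).

Lemma sei_prob_set1 (s : run V) : P [set s]%classic = (sei_pmf T B r v s)%:E.
Proof. by rewrite /sei_prob esum_set1 // lee_fin sei_pmf_ge0. Qed.

(** There are finitely many runs, so [f] is a finite nonnegative combination of indicators of
    singletons. Signed functions are then split into positive and negative parts. *)
Let ge0_integral_sei_prob (f : run V -> R) : (forall s, 0 <= f s) ->
  (\int[P]_s (f s)%:E =
   (\sum_(s : #|V|.-bseq {set V}) sei_pmf T B r v s * f s)%:E)%E.
Proof.
move=> f0.
have fE s : (f s)%:E = (\sum_(t : #|V|.-bseq {set V})
    (f t)%:E * (\1_[set t]%classic s)%:E)%E.
  rewrite (bigD1 (s : #|V|.-bseq _)) //= big1 ?adde0 => [|t ts].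
    by rewrite indicE mem_set // mule1.
  by rewrite indicE memNset ?mule0 //= => st; rewrite st eqxx in ts.
under eq_integral do rewrite fE.
rewrite ge0_integral_sum //; last first.
  by move=> t s _; rewrite -EFinM lee_fin mulr_ge0.
rewrite -sumEFin; apply: eq_bigr => t _.
rewrite ge0_integralZl ?lee_fin //.
by rewrite integral_indic // setIT EFinM muleC -sei_prob_set1.
Qed.

Lemma expectation_sei_prob (f : run V -> R) :
  ('E_P[f] = (\sum_(s : #|V|.-bseq {set V}) sei_pmf T B r v s * f s)%:E)%E.
Proof.
rewrite unlock integralE.
under eq_integral do rewrite funeposE -EFin_max.
rewrite ge0_integral_sei_prob => [|s]; last by rewrite le_max lexx orbT.
under eq_integral do rewrite funenegE -EFinN -EFin_max.
rewrite ge0_integral_sei_prob => [|s]; last by rewrite le_max lexx orbT.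
rewrite -EFinB -sumrB; congr EFin; apply: eq_bigr => s _.
rewrite -mulrBr; congr (_ * _).
by case: (leP 0 (f s)) => f0; [rewrite max_r|rewrite max_l]; lra.
Qed.

Lemma variance_sei_prob (f : run V -> R) mu : ('E_P[f] = mu%:E)%E ->
  ('V_P[f] = (\sum_(s : #|V|.-bseq {set V})
     sei_pmf T B r v s * (f s - mu) ^+ 2)%:E)%E.
Proof.
by move=> fmu; rewrite /variance unlock fmu expectation_sei_prob.
Qed.

End expectation.

(** * The law of one step, and averages over runs of bounded length *)

Section sei.
Context {R : realType} {V : finType} (T : rooted_tree V) (B : nat) (r : V -> R).
Hypotheses (B_gt0 : (0 < B)%N) (r_gt0 : forall x, 0 < r x).
Implicit Types (u v w : {set V}) (s : seq {set V}) (f g : seq {set V} -> R).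

Local Notation S := (hchildren T).
Local Notation step := (sei_step T B r).
Local Notation q u w := (Defs.total r (S u) / Defs.total r w).

(** Once the first element [x] is fixed, a hyperchild [w] containing [x] comes from the single
    completion [w :\ x]. *)
Lemma sum_completions u x w (k : R) : x \in S u ->
  \sum_(A in completions T B u x | x |: A == w) k =
  if (w \in hyperchildren T B u) && (x \in w) then k else 0.
Proof.
move=> xu; have Sgt0 : (0 < #|S u|)%N by apply/card_gt0P; exists x.
(* This makes the [.-1] in [completions] a true predecessor, so that adding [x] restores the size
   [minn B #|S u|]. *)
have Mgt0 : (0 < minn B #|S u|)%N by rewrite leq_min B_gt0.
case: ifP => [/andP[wH xw]|].
  rewrite (big_pred1 (w :\ x)) // => A /=; rewrite inE /=.
  move: wH; rewrite inE => /andP[wS /eqP cw].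
  apply/andP/eqP => [[/andP[AS _] /eqP <-]|->].
    have xA : x \notin A.
      by apply/negP => /(fintype.subsetP AS); rewrite !inE eqxx.
    by rewrite finset.setU1K.
  rewrite finset.setD1K // eqxx finset.setSD //= -cw.
  by rewrite [in X in _ == X](cardsD1 x w) xw.
move=> wx; rewrite big_pred0 // => A; apply/negP => /andP[].
rewrite inE => /andP[AS /eqP cA] /eqP Aw.
move: wx; rewrite -Aw finset.setU11 andbT inE finset.subUset finset.sub1set xu.
rewrite (fintype.subset_trans AS) ?finset.subsetDl //=.
rewrite cardsU1 cA; have -> : x \notin A.
  by apply/negP => /(fintype.subsetP AS); rewrite !inE eqxx.
by rewrite add1n prednK // eqxx.
Qed.

Lemma hyperchildren_neq0 u w :
  S u != finset.set0 -> w \in hyperchildren T B u -> w != finset.set0.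
Proof.
move=> Su; rewrite inE => /andP[_ /eqP cw].
by rewrite -card_gt0 cw leq_min B_gt0 card_gt0.
Qed.

(** Any element [x] of [w] may come first, with probability proportional to [r x]. The number of
    completions does not depend on [x], so these contributions add up to a multiple of
    [total r w]. *)
Lemma sei_step_weight u w : w \in hyperchildren T B u ->
  step u w = Defs.total r w / Defs.total r (S u) /
             'C(#|S u|.-1, (minn B #|S u|).-1)%:R.
Proof.
move=> wH; rewrite /sei_step.
under eq_bigr => x xu do rewrite sum_completions // card_completions // wH /=.
rewrite mulrAC -mulrA /Defs.total mulr_suml big_mkcond [in RHS]big_mkcond /=.
apply: eq_bigr => x _; have [xw|] := boolP (x \in w); last first.
  by rewrite mulr0 if_same.
move: wH; rewrite inE => /andP[/fintype.subsetP -> //].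
by rewrite mulrCA mulrC mulrA mulrAC.
Qed.

(** The factor [q u w] cancels the bias of the step and leaves the constant weight [N^-1] on every
    hyperchild, while each [x] in [S u] lies in exactly [N] of them. *)
Lemma sum_sei_step_ratio u (F : V -> R) : S u != finset.set0 ->
  \sum_w step u w * (q u w * \sum_(x in w) F x) = \sum_(x in S u) F x.
Proof.
move=> Su; pose N : R := 'C(#|S u|.-1, (minn B #|S u|).-1)%:R.
transitivity (\sum_(w in hyperchildren T B u) \sum_(x in w) N^-1 * F x).
  rewrite [RHS]big_mkcond; apply: eq_bigr => w _; case: ifPn => [wH|wH]; last first.
    by rewrite sei_step_hyperchildren // mul0r.
  rewrite sei_step_weight // -mulr_sumr -/N mulrA; congr (_ * _).
  have := total_gt0 r_gt0 (hyperchildren_neq0 Su wH).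
  move=> /lt0r_neq0 w0; have := total_gt0 r_gt0 Su => /lt0r_neq0 S0.
  by rewrite -[q u w]invf_div mulrAC divff ?mul1r // mulf_neq0 ?invr_eq0.
rewrite (exchange_big_dep (mem (S u))) /=; last first.
  by move=> w x; rewrite inE => /andP[/fintype.subsetP wS _] /wS.
apply: eq_bigr => x xu; rewrite big_mkcond /=.
(* Hyperchildren containing [x] are counted through the completions of [x]. *)
under eq_bigr => w _ do rewrite -(sum_completions w (N^-1 * F x) xu).
rewrite (exchange_big_dep (mem (completions T B u x))) /=; last first.
  by move=> w A _ /andP[].
under eq_bigr => A Au.
  rewrite (eq_bigl (pred1 (x |: A))); last by move=> w; rewrite Au eq_sym.
  rewrite big_pred1_eq; over.
rewrite sumr_const card_completions // -mulr_natl mulVKf //.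
by rewrite pnatr_eq0 -lt0n -(card_completions _ xu) completions_gt0.
Qed.

(** The length bound [n] is free so that it can drop by one at each step; at [#|V|] this is the
    expectation under [sei_prob]. *)
Definition run_mean n u f : R :=
  \sum_(s : n.-bseq {set V}) sei_pmf T B r u s * f s.

Lemma run_mean_leaf n u f : S u = finset.set0 -> run_mean n u f = f [::].
Proof.
move=> Su; rewrite /run_mean (bigD1 ([bseq] : n.-bseq _)) //=.
rewrite Su eqxx mul1r big1 ?addr0 // => -[[|w s] ss].
  by move/eqP; case; exact: val_inj.
by rewrite /= Su eqxx mul0r.
Qed.

Lemma run_mean_step n u f : S u != finset.set0 ->
  run_mean n.+1 u f = \sum_w step u w * run_mean n w (fun s => f (w :: s)).
Proof.
move=> Su; rewrite /run_mean (big_bseqS n (fun s => sei_pmf T B r u s * f s)) /=.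
rewrite (negbTE Su) mul0r add0r; apply: eq_bigr => w _.
by rewrite mulr_sumr; apply: eq_bigr => s _; rewrite mulrA.
Qed.

Lemma eq_run_mean n u f g : f =1 g -> run_mean n u f = run_mean n u g.
Proof. by move=> fg; apply: eq_bigr => s _; rewrite fg. Qed.

Lemma run_meanD n u f g :
  run_mean n u (fun s => f s + g s) = run_mean n u f + run_mean n u g.
Proof. by rewrite -big_split; apply: eq_bigr => s _; rewrite mulrDr. Qed.

Lemma run_meanZ n u a f : run_mean n u (fun s => a * f s) = a * run_mean n u f.
Proof. by rewrite mulr_sumr; apply: eq_bigr => s _; rewrite mulrCA. Qed.

(* As depths are below [#|V|], this leaves room for at most [n] levels of nodes
   from [u] downwards; [n] is the measure in the inductions on the algorithm. *)
Definition levels n u := forall x, x \in u -> (#|V| <= depth T x + n)%N.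

Lemma levels_card u : levels #|V| u.
Proof. by move=> x _; rewrite leq_addl. Qed.

(** Every depth is below [#|V|], so [u] must be empty. *)
Lemma levels0 u : levels 0 u -> S u = finset.set0.
Proof.
move=> u0; have -> : u = finset.set0.
  apply/eqP; apply: contraT => /set0Pn[x /u0]; rewrite addn0 leqNgt.
  by rewrite (leq_trans (findex_max (fconnect_root T x))) // max_card.
by rewrite /hchildren big_set0.
Qed.

Lemma levels_sub n u w : levels n.+1 u -> w \subset S u -> levels n w.
Proof.
move=> un /fintype.subsetP wS x /wS /bigcupP[y yu /depth_child ->].
by rewrite addSnnS un.
Qed.

Lemma levels_ind (Q : nat -> {set V} -> Prop) :
  (forall n u, S u = finset.set0 -> Q n u) ->
  (forall n u, levels n.+1 u -> S u != finset.set0 ->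
     (forall w, w \subset S u -> levels n w /\ Q n w) -> Q n.+1 u) ->
  forall n u, levels n u -> Q n u.
Proof.
move=> Qleaf Qstep; elim=> [|n IHn] u un; first exact/Qleaf/levels0.
have [/Qleaf //|Su] := eqVneq (S u) finset.set0.
apply: Qstep => // w wS; have wn := levels_sub un wS.
by split=> //; exact: IHn.
Qed.

End sei.

(** * First and second moments of the estimator and of [alpha] *)

Section moments.
Context {R : realType} {V : finType} (T : rooted_tree V) (B : nat) (r : V -> R).
Hypotheses (B_gt0 : (0 < B)%N) (r_gt0 : forall x, 0 < r x).
Variable c : V -> R.
Hypothesis c_ge0 : forall x, 0 <= c x.
Implicit Types (u v w : {set V}) (s : seq {set V}) (f : seq {set V} -> R).

Local Notation S := (hchildren T).
Local Notation step := (sei_step T B r).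
Local Notation pmf := (sei_pmf T B r).
Local Notation mean := (run_mean T B r).
Local Notation q u w := (Defs.total r (S u) / Defs.total r w).

(** Of the two conditions on [w], inclusion lets an induction go down one level, and positive
    probability lets [runs_cost_gt0] pass to [w]. *)
Lemma eq_sum_sei_step u (F G : {set V} -> R) :
  (forall w, w \subset S u -> 0 < step u w -> F w = G w) ->
  \sum_w step u w * F w = \sum_w step u w * G w.
Proof.
move=> FG; apply: eq_bigr => w _; have [wS|wS] := boolP (w \subset S u).
  have := sei_step_ge0 T B r_gt0 u w; rewrite le_eqVlt => /predU1P[<-|p0].
    by rewrite !mul0r.
  by rewrite FG.
by rewrite sei_step_subset // !mul0r.
Qed.

Lemma ler_sum_sei_step u (F G : {set V} -> R) :
  (forall w, w \subset S u -> 0 < step u w -> F w <= G w) ->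
  \sum_w step u w * F w <= \sum_w step u w * G w.
Proof.
move=> FG; apply: ler_sum => w _; have [wS|wS] := boolP (w \subset S u).
  have := sei_step_ge0 T B r_gt0 u w; rewrite le_eqVlt => /predU1P[<-|p0].
    by rewrite !mul0r.
  by rewrite ler_wpM2l ?FG // ltW.
by rewrite sei_step_subset // !mul0r.
Qed.

Lemma run_mean1 n u : levels T n u -> mean n u (fun=> 1) = 1.
Proof.
move: n u; apply: levels_ind => n u => [Su|un Su IHn].
  by rewrite run_mean_leaf.
rewrite run_mean_step // (eq_sum_sei_step (G := fun=> 1)) => [|w wS _].
  by under eq_bigr do rewrite mulr1; exact: sum_sei_step.
by case: (IHn w wS).
Qed.

Lemma run_mean_cst n u a : levels T n u -> mean n u (fun=> a) = a.
Proof.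
move=> un; rewrite -[RHS]mulr1 -(run_mean1 un) -run_meanZ.
by apply: eq_run_mean => s; rewrite mulr1.
Qed.

Lemma run_mean_centered n u f mu : levels T n u -> mean n u f = mu ->
  mean n u (fun s => (f s - mu) ^+ 2) = mean n u (fun s => f s ^+ 2) - mu ^+ 2.
Proof.
move=> un fmu; pose g s := f s ^+ 2 + (- (mu *+ 2) * f s + mu ^+ 2).
rewrite (@eq_run_mean _ _ _ _ _ _ _ _ g); last by move=> s; rewrite /g; ring.
by rewrite !run_meanD run_meanZ run_mean_cst // fmu; ring.
Qed.

Let estimator u s : R := #|u|%:R * C_SEI T r c u s.

(** Every term added to [C] carries the current [D] as a factor, so the initial values can be pulled
    out. *)
Lemma sei_loop_affine u D C s :
  sei_loop T r c u D C s = C + D * sei_loop T r c u 1 0 s.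
Proof.
elim: s u D C => [|w s IHs] u D C /=; first by rewrite mulr0 addr0.
by rewrite IHs [X in _ = _ + D * X]IHs !mul1r; ring.
Qed.

Let estimator_nil u : estimator u [::] = Defs.total c u.
Proof.
rewrite /estimator /C_SEI /=; have [->|u0] := eqVneq u finset.set0.
  by rewrite cards0 mul0r /Defs.total big_set0.
by rewrite mulrC divfK // pnatr_eq0 cards_eq0.
Qed.

(** The sizes in the ratio [#|w| / #|u|] of the update of [D] are absorbed by the leading factors of
    the two estimators. *)
Let estimator_cons u w s : u != finset.set0 ->
  estimator u (w :: s) = Defs.total c u + q u w * estimator w s.
Proof.
move=> u0; have u0' : #|u|%:R != 0 :> R by rewrite pnatr_eq0 cards_eq0.
rewrite /estimator /C_SEI /= sei_loop_affine [in RHS]sei_loop_affine.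
(* With these quotients opaque, [field] asks only for [#|u|] to be nonzero; [w] may be empty. *)
rewrite !mul1r; move: (Defs.total c w / _) (Defs.total r _ / _) => t y.
by field.
Qed.

Let hchildren_neq0 u : S u != finset.set0 -> u != finset.set0.
Proof. by apply: contraNneq => ->; rewrite /hchildren big_set0. Qed.

Lemma run_mean_estimator n u : levels T n u -> mean n u (estimator u) = hCost T c u.
Proof.
move: n u; apply: levels_ind => n u => [Su|un Su IHn].
  by rewrite run_mean_leaf // estimator_nil hCost_hchildren Su /hCost big_set0 addr0.
rewrite run_mean_step //.
rewrite (eq_sum_sei_step (G := fun w => Defs.total c u + q u w * hCost T c w)).
  under eq_bigr do rewrite mulrDr.
  rewrite big_split /= -mulr_suml sum_sei_step // mul1r.
  by rewrite sum_sei_step_ratio // -hCost_hchildren.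
move=> w wS _; have [wn IHw] := IHn w wS.
rewrite (eq_run_mean _ _ _ _ _ (fun s => estimator_cons w s (hchildren_neq0 Su))).
by rewrite run_meanD run_meanZ run_mean_cst // IHw.
Qed.

(** The positivity assumption of the theorem, put in terms of runs of length at most [n] from [u], a
    form that the next hypernode inherits. *)
Definition runs_cost_gt0 n u := forall s : n.-bseq {set V}, 0 < pmf u s ->
  forall w, w \in u :: s -> S w != finset.set0 -> 0 < hCost T c (S w).

(** The probabilities of the runs from [u] sum to 1, so some run has positive probability, and [u]
    occurs at its head. *)
Lemma hCost_hchildren_gt0 n u : levels T n u -> runs_cost_gt0 n u ->
  S u != finset.set0 -> 0 < hCost T c (S u).
Proof.
move=> un gu Su; case: (pselect (exists s : n.-bseq {set V}, 0 < pmf u s)).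
  by case=> s /gu; apply=> //; rewrite mem_head.
move=> ns; have := @ltr01 R; rewrite -(run_mean1 un) /run_mean big1 ?ltxx //.
move=> s _; rewrite mulr1; apply/eqP; rewrite eq_le sei_pmf_ge0 // andbT leNgt.
by apply/negP => us; apply: ns; exists s.
Qed.

Lemma runs_cost_gt0_step n u w : S u != finset.set0 -> 0 < step u w ->
  runs_cost_gt0 n.+1 u -> runs_cost_gt0 n w.
Proof.
move=> Su uw gu s ws w' w's; apply: (gu [bseq of w :: s]) => //=.
  by rewrite (negbTE Su) mulr_gt0.
by rewrite inE w's orbT.
Qed.

Lemma run_mean_alpha n u : levels T n u -> runs_cost_gt0 n u ->
  mean n u (alpha T r c u) = 1.
Proof.
move: n u; apply: levels_ind => n u => [Su|un Su IHn].
  by rewrite run_mean_leaf.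
move=> gu; have /lt0r_neq0 K0 := hCost_hchildren_gt0 un gu Su.
rewrite run_mean_step //.
rewrite (eq_sum_sei_step (G := fun w => q u w * hCost T c w / hCost T c (S u))).
  under eq_bigr do rewrite mulrA.
  by rewrite -mulr_suml sum_sei_step_ratio // divff.
move=> w wS uw; have [wn IHw] := IHn w wS.
by rewrite run_meanZ IHw ?mulr1 ?mulrA //; exact: runs_cost_gt0_step gu.
Qed.

Lemma second_moment n u : levels T n u -> runs_cost_gt0 n u ->
  mean n u (fun s => estimator u s ^+ 2) <=
  hCost T c u ^+ 2 * mean n u (fun s => alpha T r c u s ^+ 2).
Proof.
move: n u; apply: levels_ind => n u => [Su _|un Su IHn gu].
  rewrite !run_mean_leaf // estimator_nil hCost_hchildren Su /hCost big_set0.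
  by rewrite addr0 /= expr1n mulr1.
have K0 := hCost_hchildren_gt0 un gu Su; have /lt0r_neq0 K1 := K0.
set A := mean n.+1 u (fun s => alpha T r c u s ^+ 2).
(* [A - 1] is the variance of [alpha], whose mean is 1. *)
have A_ge1 : 1 <= A.
  have := run_mean_centered un (run_mean_alpha un gu).
  rewrite -/A expr1n => AE; rewrite -subr_ge0 -AE.
  by apply: sumr_ge0 => s _; rewrite mulr_ge0 ?sqr_ge0 ?sei_pmf_ge0.
set K := hCost T c (S u) in K0 K1; set a := Defs.total c u.
(* Multiplying by [K ^+ 2] clears the denominator of the first factor of [alpha]. *)
have AE : K ^+ 2 * A = \sum_w step u w * (q u w ^+ 2 *
    (hCost T c w ^+ 2 * mean n w (fun s => alpha T r c w s ^+ 2))).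
  rewrite /A run_mean_step // mulr_sumr; apply: eq_bigr => w _.
  rewrite mulrCA; congr (_ * _).
  rewrite -!run_meanZ; apply: eq_run_mean => s /=.
  by rewrite -/K -!exprMn; congr (_ ^+ _); move: (q u w) => y; field.
(* Expand the square of the recursion [estimator_cons]; the cross term is evaluated by the mean of
   the estimator at [w] and then by [sum_sei_step_ratio]. *)
have -> : mean n.+1 u (fun s => estimator u s ^+ 2) =
    a ^+ 2 + a *+ 2 * K + \sum_w step u w * (q u w ^+ 2 *
      mean n w (fun s => estimator w s ^+ 2)).
  rewrite run_mean_step // (eq_sum_sei_step (G := fun w => a ^+ 2 +
    (a *+ 2 * (q u w * hCost T c w) +
     q u w ^+ 2 * mean n w (fun s => estimator w s ^+ 2)))).
    under eq_bigr do rewrite !mulrDr [X in _ + (X + _)]mulrCA.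
    rewrite !big_split /= -mulr_suml sum_sei_step // mul1r -mulr_sumr.
    by rewrite sum_sei_step_ratio // addrA.
  move=> w wS _; have [wn _] := IHn w wS.
  pose g s := a ^+ 2 +
    (a *+ 2 * q u w * estimator w s + q u w ^+ 2 * estimator w s ^+ 2).
  rewrite (@eq_run_mean _ _ _ _ _ _ _ _ g) => [|s].
    rewrite !run_meanD run_mean_cst // (run_meanZ _ _ _ _ _ _ (estimator w)).
    by rewrite run_mean_estimator // (run_meanZ _ _ _ _ _ (q u w ^+ 2)) !mulrA.
  rewrite (estimator_cons _ _ (hchildren_neq0 Su)) /g -/a.
  by move: (estimator w s) (q u w) => x y; ring.
have S2 : \sum_w step u w * (q u w ^+ 2 * mean n w (fun s => estimator w s ^+ 2))
    <= K ^+ 2 * A.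
  rewrite AE; apply: ler_sum_sei_step => w wS uw; have [wn IHw] := IHn w wS.
  by rewrite ler_wpM2l ?sqr_ge0 // IHw //; exact: runs_cost_gt0_step gu.
have a0 : 0 <= a by apply: sumr_ge0.
rewrite hCost_hchildren -/K -/a.
(* Since [(a + K) ^+ 2 * A] is [(a ^+ 2 + a *+ 2 * K) * A + K ^+ 2 * A], adding this bound to [S2]
   gives the goal. *)
have : (a ^+ 2 + a *+ 2 * K) * 1 <= (a ^+ 2 + a *+ 2 * K) * A.
  by rewrite ler_wpM2l // addr_ge0 ?sqr_ge0 // mulr_ge0 ?mulrn_wge0 // ltW.
move: S2; set M := \sum_w _; nra.
Qed.

End moments.

(** A step of nonzero probability lands inside [hchildren T u], whose nodes share one depth. This
    gives access to the positivity assumption of the theorem, which is stated for hypernodes. *)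
Lemma sei_pmf_hypernode {R : realType} {V : finType} (T : rooted_tree V) (B : nat)
    (r : V -> R) (u : {set V}) (s : seq {set V}) :
  is_hypernode T u -> sei_pmf T B r u s != 0 ->
  {in u :: s, forall w, is_hypernode T w}.
Proof.
elim: s u => [|w s IHs] u hu /=; first by move=> _ w; rewrite inE => /eqP ->.
case: ifP => [|_]; rewrite ?eqxx // mulf_eq0 negb_or => /andP[uw ws] w'.
rewrite in_cons => /predU1P[-> //|]; apply: IHs => //.
apply: is_hypernode_sub hu _; apply: contraNT uw => wS.
by rewrite sei_step_subset.
Qed.

Theorem theorem6 (R : realType) (V : finType) (T : rooted_tree V)
    (c : V -> R) (c_ge0 : forall x : V, 0 <= c x)
    (B : nat) (B_ge1 : (1 <= B)%N)
    (r : V -> R) (r_gt0 : forall x : V, 0 < r x)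
    (v : {set V}) (v_hypernode : is_hypernode T v) (v_neq0 : v != finset.set0)
    (Cost_v_gt0 : 0 < hCost T c v)
    (Cost_S_gt0 : forall u : {set V}, is_hypernode T u ->
       hchildren T u != finset.set0 ->
       (0 < sei_prob T B r_gt0 v [set s : run V | u \in v :: s]%classic)%E ->
       0 < hCost T c (hchildren T u)) :
  (CV2 (sei_prob T B r_gt0 v)
       (fun s : run V => (#|v|%:R * C_SEI T r c v s)%R)
   <= 'V_(sei_prob T B r_gt0 v)[fun s : run V => alpha T r c v s])%E.
Proof.
have vn : levels T #|V| v by exact: levels_card.
have gv : runs_cost_gt0 T B r c #|V| v.
  move=> s vs w ws Sw; apply: Cost_S_gt0 => //.
    by apply: (sei_pmf_hypernode (B := B) (r := r)) ws => //; rewrite gt_eqF.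
  (* The event that [w] occurs contains the single run [s], which has positive probability. *)
  apply: (@lt_le_trans _ _ (sei_prob T B r_gt0 v [set (s : run V)]%classic)).
    by rewrite sei_prob_set1.
  by apply: le_measure; rewrite ?inE // => _ ->.
have EZ := run_mean_estimator B_ge1 r_gt0 c vn.
have EA := run_mean_alpha B_ge1 r_gt0 vn gv.
have VZ := run_mean_centered r_gt0 vn EZ; have VA := run_mean_centered r_gt0 vn EA.
rewrite /CV2 (variance_sei_prob (mu := hCost T c v)); last first.
  by rewrite expectation_sei_prob; congr EFin.
rewrite (variance_sei_prob (mu := 1)); last first.
  by rewrite expectation_sei_prob; congr EFin.
rewrite [X in (_ / X ^+ 2)%E](_ : _ = (hCost T c v)%:E); last first.
  by rewrite expectation_sei_prob; congr EFin.
rewrite [X in (X%:E / _)%E]VZ [X in (_ <= X%:E)%E]VA.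
(* As [hCost T c v] is positive, the extended inverse is the real one and not [+oo]. *)
rewrite -EFin_expe inver expf_eq0 /= gt_eqF // -EFinM lee_fin.
(* After clearing the squared mean, it is subtracted on both sides and cancels. *)
rewrite ler_pdivrMr ?exprn_gt0 // expr1n mulrBl mul1r lerD2r mulrC.
exact: second_moment.
Qed.
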